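(* Let $d\ge 1$. Assume $v\in L_0^2(\mathbb{T}^d)$ and $v\neq 0$. For any $f\in L_0^2(\mathbb{T}^d)$ with $f\neq 0$ and for any $\epsilon>0$, there exist a finite set $N\subset \mathbb{Z}^d\setminus \{0\}$, a positive integer $J$, and matrices $\mathbf{L}_1,\ldots,\mathbf{L}_J\in T(N,\mathbb{C})$ such that the function $\mathbf{G}=Q_N\mathrm{e}^{\mathbf{L}_1}\cdots \mathrm{e}^{\mathbf{L}_{J}}Q_N^*v$ satisfies $\Vert f-\mathbf{G}\Vert\le \epsilon$, where $\Vert\cdot\Vert$ is the norm of $L^2(\mathbb{T}^d)$.
   Context: $\mathbb{T}=\mathbb{R}/2\pi\mathbb{Z}$, and $L^2(\mathbb{T}^d)$ is the space of complex-valued square-integrable functions on $\mathbb{T}^d$ with respect to the normalized Lebesgue measure (total mass $1$). For $n\in\mathbb{Z}^d$ let $q_n(x)=\mathrm{e}^{\mathrm{i}n\cdot x}$, so that $\{q_n\}_{n\in\mathbb{Z}^d}$ is an orthonormal basis. $L_0^2(\mathbb{T}^d)=\overline{\operatorname{Span}\{q_n\mid n\neq 0\}}$ is the subspace of functions with average $0$. For a finite set $N\subset\mathbb{Z}^d$, $\mathbb{C}^N$ denotes vectors indexed by $N$ and $\mathbb{C}^{N\times N}$ denotes matrices $[a_{n,l}]_{n,l\in N}$ with rows and columns indexed by $N$. $Q_N:\mathbb{C}^N\to V_N:=\operatorname{Span}\{q_n\mid n\in N\}\subset L^2(\mathbb{T}^d)$ is $Q_Nc=\sum_{n\in N}c_nq_n$,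 and $Q_N^*:L^2(\mathbb{T}^d)\to\mathbb{C}^N$ is its adjoint, $Q_N^*v=(\langle q_n,v\rangle)_{n\in N}$ (inner product conjugate-linear in the first argument); $Q_NQ_N^*$ is the orthogonal projection onto $V_N$. A matrix $A\in\mathbb{C}^{N\times N}$ is called Toeplitz if its $(n,l)$-entry depends only on the difference $n-l\in\mathbb{Z}^d$. For $k=1,\ldots,d$, $D_k\in\mathbb{C}^{N\times N}$ is the diagonal matrix with $(D_k)_{l,l}=\mathrm{i}l_k$, where $l_k$ is the $k$th component of $l\in N\subset\mathbb{Z}^d$. Finally $$T(N,\mathbb{C})=\Big\{\sum_{k=1}^dA_1^{k}\cdots A_{R_k}^{k} D_k\ \Big|\ R_k\in\mathbb{N}\ (R_k\ge 1),\ A_1^{k},\ldots, A_{R_k}^{k}\in\mathbb{C}^{N\times N}\text{ Toeplitz}\ (k=1,\ldots,d)\Big\}.$$ *)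

(* Defs.v *)
From HB Require Import structures.
From mathcomp Require Import all_boot all_order all_algebra finmap.
From mathcomp Require Import all_classical all_reals all_analysis.
From mathcomp Require Import complex.

Set Implicit Arguments.
Unset Strict Implicit.
Unset Printing Implicit Defensive.

Import Order.TTheory GRing.Theory Num.Theory.
Import numFieldNormedType.Exports.

Local Open Scope classical_set_scope.
Local Open Scope ring_scope.

(* A function on T^d = (R / 2 pi Z)^d is a function on d.-tuple R that is
   2 pi-periodic in each coordinate; integrals are taken over the fundamental
   domain [0, 2 pi]^d. *)

Section TorusMeasure.
Variable R : realType.

Lemma two_pi_gt0 : (0 : R) < 2 * pi.
Proof. by rewrite mulr_gt0 ?ltr0n ?pi_gt0. Qed.

Definition circle_prob : probability (measurableTypeR R) R :=
  uniform_prob two_pi_gt0.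

Definition tcons d (p : measurableTypeR R * d.-tuple (measurableTypeR R)) :
  d.+1.-tuple (measurableTypeR R) := [tuple of p.1 :: p.2].

Lemma measurable_tcons d : measurable_fun setT (@tcons d).
Proof. exact: measurable_cons. Qed.

HB.instance Definition _ d :=
  isMeasurableFun.Build _ _ _ _ (@tcons d) (@measurable_tcons d).

(* Normalized Lebesgue measure on [0, 2 pi]^d, as a d-fold product. *)
Fixpoint torus_prob d : probability (d.-tuple (measurableTypeR R)) R :=
  match d with
  | 0 => dirac [tuple]
  | d'.+1 => distribution (circle_prob \x torus_prob d')%E (@tcons d')
  end.

End TorusMeasure.

Section LTwoTorus.
Variables (R : realType) (d : nat).
Local Open Scope complex_scope.

Local Notation point := (d.-tuple (measurableTypeR R)).
Local Notation freq := 'rV[int]_d.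
Local Notation mu := (torus_prob R d).

Implicit Types (f g : point -> R[i]) (n : freq) (N : {fset freq}) (x : point).

Definition periodic f := forall (k : 'I_d) x,
  f [tuple tnth x l + (2 * pi) *+ (l == k) | l < d] = f x.

Definition L2norm f : \bar R :=
  'N[mu]_2%:E[EFin \o (@ComplexField.Normc.normc R \o f)]%E.

(* Elements of L^2 are represented by functions; equality in L^2 is equality
   almost everywhere. *)
Definition L2 f := [/\ periodic f,
  measurable_fun setT (fun x => complex.Re (f x)),
  measurable_fun setT (fun x => complex.Im (f x)) &
  (L2norm f < +oo)%E].

Definition cintegral f : R[i] :=
  (\int[mu]_x complex.Re (f x)) +i* (\int[mu]_x complex.Im (f x)).

Definition inner f g : R[i] := cintegral (fun x => (f x)^* * g x).

Definition q n x : R[i] :=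
  let t := \sum_(k < d) (n 0 k)%:~R * tnth x k in cos t +i* sin t.

(* Vectors and matrices indexed by the finite set N are those of size #|N|,
   along the enumeration enum_val of N. *)
Definition idx N (i : 'I_#|{: N}|) : freq := val (enum_val i).

Definition Q N (c : 'cV[R[i]]_#|{: N}|) x : R[i] :=
  \sum_i c i 0 * q (idx i) x.

Definition Qadj N f : 'cV[R[i]]_#|{: N}| := \col_i inner (q (idx i)) f.

(* The closure in L^2 of Span {q_n | n != 0}. *)
Definition L20 f := L2 f /\ forall e : R, 0 < e ->
  exists (N : {fset freq}) (c : 'cV[R[i]]_#|{: N}|),
    0 \notin N /\ (L2norm (f \- Q c)%R <= e%:E)%E.

Definition toeplitz N (A : 'M[R[i]]_#|{: N}|) :=
  exists a : freq -> R[i], forall i j, A i j = a (idx i - idx j).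

Definition Dmx N (k : 'I_d) : 'M[R[i]]_#|{: N}| :=
  \matrix_(i, j) ((0 +i* (idx i 0 k)%:~R) *+ (i == j)).

Definition Tset N (L : 'M[R[i]]_#|{: N}|) :=
  exists (r : 'I_d -> nat) (A : forall k : 'I_d, 'I_(r k) -> 'M[R[i]]_#|{: N}|),
    [/\ forall k, (0 < r k)%N, forall k s, toeplitz (A k s) &
        L = \sum_(k < d) (\prod_(s < r k) A k s) *m Dmx N k].

End LTwoTorus.

(* The exponential series, summed entrywise; the limit is taken separately on
   real and imaginary parts, as limn is applied in R. *)
Definition expmx (R : realType) m (A : 'M[R[i]]_m) : 'M[R[i]]_m :=
  let S n := \sum_(0 <= k < n) (k`!%:R : R[i])^-1 *: A ^+ k in
  \matrix_(i, j) Complex (limn (fun n => complex.Re (S n i j)))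
                         (limn (fun n => complex.Im (S n i j))).

(* Main.v *)
(** Since [f] is only approximated, one may add to its frequencies, and to one
    frequency [b] at which [v] has a nonzero Fourier coefficient, a single
    frequency [m] so far away that no difference [m - l] or [l - m] occurs
    elsewhere as a difference of frequencies.  Every matrix supported on the
    column of [m] with zero diagonal entry, and every multiple of the elementary
    matrix at [(m, b)], is then Toeplitz, and stays so after division by a
    nonzero diagonal entry of some [D_k].  These matrices have square zero, so
    their exponentials are transvections.  Two of them suffice: the first feeds a
    small nonzero amount into the coordinate [m] from the coordinate [b], the
    second uses the coordinate [m] to correct all the others.  The error is that
    of the trigonometric approximation of [f] plus the amount left at [m]. *)

Require Import Defs.
From mathcomp Require Import all_boot all_order all_algebra finmap.
From mathcomp Require Import all_classical all_reals all_analysis measurable_realfun.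
From mathcomp Require Import complex zify ring lra.

Set Implicit Arguments.
Unset Strict Implicit.
Unset Printing Implicit Defensive.

Import Order.TTheory GRing.Theory Num.Theory.
Import numFieldNormedType.Exports.

Local Open Scope classical_set_scope.
Local Open Scope ring_scope.

(** * Exponentials of square-zero matrices *)

Section Transvections.
Variable R : realType.

Lemma expmx_sqr0 n (A : 'M[R[i]]_n) : A *m A = 0 -> expmx A = 1%:M + A.
Proof.
move=> A2; apply/matrixP => i j.
(* From two terms on, the partial sums of the exponential series are constant. *)
have S k : \sum_(0 <= l < k.+2) (l`!%:R : R[i])^-1 *: A ^+ l = 1%:M + A.
  rewrite big_nat_recl// big_nat_recl// big1_seq => [|l _].
    by rewrite addr0 !fact0 factS fact0 muln1 !invr1 !scale1r expr0 expr1.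
  by rewrite !exprS mulrA [A * A]A2 mul0r scaler0.
have S2 (p : R[i] -> R) : limn (fun l =>
    p ((\sum_(0 <= t < l) (t`!%:R : R[i])^-1 *: A ^+ t) i j)) = p ((1%:M + A) i j).
  apply: lim_near_cst => //; exists 2%N => // -[|[|l]] //= _.
  by rewrite S.
by rewrite mxE (S2 (@complex.Re R)) (S2 (@complex.Im R)); case: (X in _ = X).
Qed.

Lemma expmx_transvection n (u w : 'cV[R[i]]_n) (j : 'I_n) : u j 0 = 0 ->
  expmx (u *m delta_mx 0 j) *m w = w + w j 0 *: u.
Proof.
move=> uj0; rewrite expmx_sqr0 => [|].
  rewrite mulmxDl mul1mx -mulmxA -rowE; congr (_ + _).
  by apply/matrixP => i l; rewrite !mxE big_ord1 !mxE !ord1 mulrC.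
rewrite -mulmxA [delta_mx _ _ *m (_ *m _)]mulmxA -rowE.
suff -> : row j u = 0 by rewrite mul0mx mulmx0.
by apply/rowP => l; rewrite !mxE ord1.
Qed.

(** The inner factor moves coordinate [m] from its value in [w] to that in [g], whence the divisor
    [w b 0]; the outer one, whose multiplier is then [g m 0], moves every other coordinate. *)
Lemma steer_by_two_transvections n (w g : 'cV[R[i]]_n) (b m : 'I_n) :
    b != m -> w b 0 != 0 -> g m 0 != 0 ->
  expmx ((\col_i (if i == m then 0 else (g i 0 - w i 0) / g m 0)) *m delta_mx 0 m)
  *m (expmx (((((g m 0 - w m 0) / w b 0) *: delta_mx m 0) : 'cV_n) *m delta_mx 0 b) *m w) = g.
Proof.
move=> bm wb gm; rewrite !expmx_transvection ?mxE ?eqxx ?(negPf bm) ?mulr0//.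
apply/colP => i; rewrite !mxE !eqxx !andbT; case: eqP => [->|_]; rewrite ?mulr1n ?mulr0n.
  by field.
by field; rewrite gm wb.
Qed.

End Transvections.

(** * Toeplitz matrices supported on one column, and far frequencies *)

Section Frequencies.
Variables (R : realType) (d : nat).
Local Notation freq := 'rV[int]_d.
Implicit Type N : {fset freq}.

Lemma idx_inj N : injective (@idx d N).
Proof. by move=> i j /val_inj/enum_val_inj. Qed.

Lemma idx_in N (i : 'I_#|{: N}|) : idx i \in N.
Proof. exact: valP. Qed.

Lemma ex_idx N n : n \in N -> exists i : 'I_#|{: N}|, idx i = n.
Proof. by move=> nN; exists (enum_rank [` nN]%fset); rewrite /idx enum_rankK. Qed.

(** Serves to express Toeplitz symbols, and sums over different sets of frequencies, by one function
    on all frequencies. *)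
Lemma ex_extension N (u : 'cV[R[i]]_#|{: N}|) : exists h : freq -> R[i],
  (forall i, u i 0 = h (idx i)) /\ (forall n, n \notin N -> h n = 0).
Proof.
exists (fun n => if insub n is Some t then u (@enum_rank {: N} t) 0 else 0); split.
  by move=> i; rewrite /idx valK enum_valK.
by move=> n nN; rewrite insubN.
Qed.

Lemma QE N (c : 'cV[R[i]]_#|{: N}|) (h : freq -> R[i]) x :
  (forall i, c i 0 = h (idx i)) -> Q c x = \sum_(n <- N) h n * q n x.
Proof.
move=> ch; rewrite big_seq_fsetE (big_enum_val (fun n : N => h (val n) * q (val n) x)).
by apply: eq_bigr => i _; rewrite ch.
Qed.

Lemma Tset_toeplitzM N (A : 'M[R[i]]_#|{: N}|) k :
  toeplitz A -> Tset (A *m Dmx R N k).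
Proof.
(* Every direction needs at least one factor; the zero matrix, itself Toeplitz, cancels those other
   than [k]. *)
move=> tA; exists (fun=> 1%N), (fun l _ => if l == k then A else 0); split=> //.
  by move=> l _; case: eqP => // _; exists (fun=> 0) => i j; rewrite mxE.
rewrite (bigD1 k)//= big_ord1 eqxx big1 ?addr0// => l lk.
by rewrite big_ord1 (negPf lk) mul0mx.
Qed.

(** As [idx j] is nonzero, some [Dmx R N k] scales column [j] by a nonzero [c]; dividing the symbol
    [a] by [c] compensates. *)
Lemma Tset_column N (u : 'cV[R[i]]_#|{: N}|) (j : 'I_#|{: N}|) (a : freq -> R[i]) :
    idx j != 0 -> (forall i l, u i 0 *+ (l == j) = a (idx i - idx l)) ->
  Tset (u *m delta_mx 0 j).
Proof.
move=> j0 ua; have [k jk] : exists k, idx j 0 k != 0.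
  by apply/existsP; apply: contraNT j0 => /existsPn jk; apply/eqP/rowP => k;
    rewrite mxE; apply/eqP; rewrite -[_ == _]negbK.
pose c : R[i] := Complex 0 (idx j 0 k)%:~R.
have c0 : c != 0 by rewrite eq_complex /= eqxx intr_eq0.
have -> : u *m delta_mx 0 j = (c^-1 *: (u *m delta_mx 0 j)) *m Dmx R N k.
  apply/matrixP => i l; rewrite [RHS]mxE (bigD1 l)//= big1 => [|t tl].
    rewrite !mxE eqxx mulr1n addr0 big_ord1 !mxE eqxx/=.
    case: eqP => [->|_]; last by rewrite !mulr0 mul0r.
    by rewrite mulr1 -/c mulrAC mulVf// mul1r.
  by rewrite [X in _ * X]mxE (negPf tl) mulr0.
apply: Tset_toeplitzM; exists (fun n => c^-1 * a n) => i l.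
rewrite !mxE -ua big_ord1 !mxE eqxx/=; congr (_ * _).
by case: (l == j); rewrite ?mulr1 ?mulr0.
Qed.

(** The second condition reads [m - x != y - m]: differences in which [m] is subtracted are excluded
    as well. *)
Definition far_from N (m : freq) := forall x y z, x \in N -> y \in N -> z \in N ->
  m - x != y - z /\ m + m != x + y.

Lemma ex_far_from N (k : 'I_d) : exists2 m : freq, m != 0 & far_from N m.
Proof.
pose K := (\sum_(n <- N) `|n 0%R k|)%N.
have NK n : n \in N -> (`|n 0%R k| <= K)%N.
  by move=> nN; rewrite /K (big_fsetD1 n)//= leq_addr.
(* [m = x + y - z] would bound coordinate [k] by [3 * K], and [m + m = x + y] would bound it by [K];
   the successor makes [m] nonzero even if [K = 0]. *)
pose m : freq := \row_j (if j == k then (3 * K).+1%:Z else 0).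
have mk : m 0 k = (3 * K).+1%:Z by rewrite mxE eqxx.
exists m; first by apply/eqP => /rowP/(_ k); rewrite mk mxE.
move=> x y z /NK xK /NK yK /NK zK; split; apply/eqP => /rowP/(_ k);
  rewrite !mxE eqxx; clear mk m NK; move: (x 0 k) (y 0 k) (z 0 k) K xK yK zK => *; lia.
Qed.

End Frequencies.

(** * Generators attached to a far frequency *)

Section FarFrequency.
Variables (R : realType) (d : nat).
Local Notation freq := 'rV[int]_d.
Variables (N0 : {fset freq}) (m : freq).
Local Notation N := (m |` N0)%fset.

(** The symbol is the column shifted by [m]. It could be nonzero off column [j] only where
    [idx i - idx l + m] lies in [N]: the value [m] gives [u j 0 = 0], the others contradict
    [far_from]. *)
Lemma Tset_far_column (u : 'cV[R[i]]_#|{: N}|) (j : 'I_#|{: N}|) :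
  far_from N0 m -> m != 0 -> idx j = m -> u j 0 = 0 -> Tset (u *m delta_mx 0 j).
Proof.
move=> m_far m0 jm uj0; have [h [uh hN]] := ex_extension u.
apply: (@Tset_column _ _ _ _ _ (fun n => h (n + m))); first by rewrite jm.
move=> i l; case: eqP => [->|/eqP lj]; first by rewrite jm subrK uh.
rewrite mulr0n; apply/esym.
have lN0 : idx l \in N0.
  by case/fset1UP: (idx_in l) => // lm; rewrite -(inj_eq (@idx_inj _ _)) lm jm eqxx in lj.
have [/fset1UP[->|zN0]|/hN//] := boolP (idx i - idx l + m \in N).
  by rewrite -jm -uh.
case/fset1UP: (idx_in i) => [im|iN0].
  have [_] := m_far _ _ _ zN0 lN0 lN0; case/negP; apply/eqP.
  by rewrite im addrAC subrK.
have [+ _] := m_far _ _ _ lN0 zN0 iN0; case/negP; apply/eqP.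
by rewrite [_ + m]addrC addrA addrAC addrK.
Qed.

(** The difference [m - idx j0] is attained by no other pair in [N], so a symbol concentrated there
    yields a single entry. *)
Lemma Tset_far_row (c : R[i]) (i0 j0 : 'I_#|{: N}|) :
  far_from N0 m -> idx i0 = m -> idx j0 \in N0 -> idx j0 != 0 ->
  Tset ((c *: delta_mx i0 0 : 'cV_#|{: N}|) *m delta_mx 0 j0).
Proof.
move=> m_far im jN0 j0N0.
apply: (@Tset_column _ _ _ _ _ (fun n => c *+ (n == m - idx j0))) => // i l.
rewrite !mxE andbT -!mulrnAr -[X in c * X]mulr_natr -natrM mulnb.
rewrite -[RHS]mulr_natr; congr (_ * _%:R); congr nat_of_bool.
rewrite -!(inj_eq (@idx_inj _ _)) im.
case/fset1UP: (idx_in i) => [->|iN0].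
  by rewrite eqxx (inj_eq (addrI _)) eqr_opp.
have /negPf -> : idx i != m.
  apply: contraTneq iN0 => ->; apply/negP => mN0.
  by have [] := m_far _ _ _ mN0 jN0 jN0; rewrite !subrr eqxx.
apply/esym/negbTE; case/fset1UP: (idx_in l) => [->|lN0].
  have [_] := m_far _ _ _ iN0 jN0 jN0; apply: contraNneq.
  by move/(canRL (subrK _)) => ->; rewrite addrAC subrK.
by rewrite eq_sym; have [] := m_far _ _ _ jN0 iN0 lN0.
Qed.

End FarFrequency.

(** * Measurability, norm estimates and orthogonality in L^2 *)

Section TorusLTwo.
Variables (R : realType) (d : nat).
Local Notation point := (d.-tuple (measurableTypeR R)).
Local Notation freq := 'rV[int]_d.
Local Notation mu := (torus_prob R d).
Implicit Types (f g : point -> R[i]) (N : {fset freq}) (x : point).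

Definition normsq (z : R[i]) : R := complex.Re z ^+ 2 + complex.Im z ^+ 2.

Definition cmeasurable f :=
  measurable_fun setT (fun x => complex.Re (f x)) /\
  measurable_fun setT (fun x => complex.Im (f x)).

Lemma normsq_ge0 z : 0 <= normsq z.
Proof. by rewrite addr_ge0 ?sqr_ge0. Qed.

Lemma normsq_eq0 z : (normsq z == 0) = (z == 0).
Proof. by rewrite paddr_eq0 ?sqr_ge0// !sqrf_eq0 eq_complex. Qed.

Lemma measurable_normsq f : cmeasurable f ->
  measurable_fun setT (fun x => (normsq (f x))%:E).
Proof.
move=> [mr mi]; apply/measurable_EFinP; apply: measurable_funD; exact: measurable_funX.
Qed.

Lemma L2normE f :
  (L2norm f `^ 2 = \int[mu]_x (normsq (f x))%:E)%E.
Proof.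
rewrite /L2norm poweR_Lnorm//; apply: eq_integral => x _ /=.
rewrite powR_mulrn// real_normK ?num_real//.
by case: (f x) => a b /=; rewrite sqr_sqrtr ?addr_ge0 ?sqr_ge0.
Qed.

Lemma L2norm_le f (e : R) : 0 <= e -> (L2norm f <= e%:E)%E <->
  (\int[mu]_x (normsq (f x))%:E <= (e ^+ 2)%:E)%E.
Proof.
move=> e0; rewrite -L2normE -powR_mulrn// -poweR_EFin.
have F0 : (0 <= L2norm f)%E by exact: Lnorm_ge0.
split=> le; first by apply: gt0_ler_poweR; rewrite ?in_itv/= ?leey ?andbT ?lee_fin.
have : ((L2norm f `^ 2) `^ 2^-1 <= (e%:E `^ 2) `^ 2^-1)%E.
  by apply: gt0_ler_poweR le; rewrite ?invr_ge0 ?in_itv/= ?leey ?andbT ?poweR_ge0// ?lee_fin ?powR_ge0.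
by rewrite -!poweRrM divff// !poweRe1.
Qed.

Lemma cmeasurableB f g : cmeasurable f -> cmeasurable g -> cmeasurable (f \- g).
Proof.
move=> [fr fi] [gr gi]; split.
  rewrite (_ : (fun _ => _) = (fun x => complex.Re (f x) - complex.Re (g x))).
    exact: measurable_funB.
  by apply/funext => x; rewrite raddfB.
rewrite (_ : (fun _ => _) = (fun x => complex.Im (f x) - complex.Im (g x))).
  exact: measurable_funB.
by apply/funext => x; rewrite raddfB.
Qed.

Lemma cmeasurableM f g : cmeasurable f -> cmeasurable g -> cmeasurable (f \* g).
Proof.
move=> [fr fi] [gr gi]; split.
  rewrite (_ : (fun _ => _) = (fun x => complex.Re (f x) * complex.Re (g x)
      - complex.Im (f x) * complex.Im (g x))).
    by apply: measurable_funB; apply: measurable_funM.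
  by apply/funext => x /=; case: (f x) (g x) => a b [].
rewrite (_ : (fun _ => _) = (fun x => complex.Re (f x) * complex.Im (g x)
    + complex.Im (f x) * complex.Re (g x))).
  by apply: measurable_funD; apply: measurable_funM.
by apply/funext => x /=; case: (f x) (g x) => a b [].
Qed.

Lemma cmeasurable_cst (c : R[i]) : cmeasurable (cst c).
Proof. by split; exact: measurable_cst. Qed.

Lemma cmeasurable_sum (I : finType) (F : I -> point -> R[i]) :
  (forall i, cmeasurable (F i)) -> cmeasurable (fun x => \sum_i F i x).
Proof.
move=> mF; split; under eq_fun do rewrite raddf_sum/=; apply: measurable_sum => i;
  by case: (mF i).
Qed.

Lemma cmeasurable_q (n : freq) : cmeasurable (q n).
Proof.
have mt : measurable_fun setT (fun x : point => \sum_(k < d) (n 0 k)%:~R * tnth x k).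
  by apply: measurable_sum => k; apply: measurable_funM => //; exact: measurable_tnth.
by split; apply: measurableT_comp mt; apply: continuous_measurable_fun;
  [exact: continuous_cos|exact: continuous_sin].
Qed.

Lemma cmeasurable_Q N (c : 'cV[R[i]]_#|{: N}|) : cmeasurable (Q c).
Proof.
apply: cmeasurable_sum => i; apply: cmeasurableM (cmeasurable_q _).
exact: cmeasurable_cst.
Qed.

Lemma normsq_q (n : freq) x : normsq (q n x) = 1.
Proof. by rewrite /normsq/= cos2Dsin2. Qed.

(** By the parallelogram law, |f - y q|^2 <= 2|f|^2 + 2y^2 with [y = e / 2]; over total mass 1 the
    right side integrates to at most e^2. *)
Lemma L2norm_subZq_le (e : R) f (n : freq) : 0 < e -> cmeasurable f ->
    (L2norm f <= (e / 2)%:E)%E ->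
  (L2norm (f \- (fun x => Complex (e / 2) 0 * q n x))%R <= e%:E)%E.
Proof.
move=> e0 mf; rewrite !L2norm_le ?(ltW e0)//; last by rewrite divr_ge0 ?ltW.
move=> le.
pose h x := (2%:E * (normsq (f x))%:E + cst (2 * (e / 2) ^+ 2)%:E x)%E.
apply: (@le_trans _ _ (\int[mu]_x h x)%E).
  apply: ge0_le_integral => //.
  - by move=> x _; rewrite lee_fin normsq_ge0.
  - apply: measurable_normsq; apply: cmeasurableB mf _.
    by apply: cmeasurableM (cmeasurable_q _); exact: cmeasurable_cst.
  - apply: emeasurable_funD => //; apply: measurable_funeM; exact: measurable_normsq.
  - move=> x _; rewrite lee_fin; have := normsq_q n x.
    change ((f \- _) x) with (f x - Complex (e / 2) 0 * q n x).
    case: (f x) (q n x) => a b [s t]; rewrite /normsq /=; set y := e / 2 => st.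
    rewrite -subr_ge0.
    rewrite [leRHS](_ : _ = (a + y * s) ^+ 2 + (b + y * t) ^+ 2
      + 2 * y ^+ 2 * (1 - (s ^+ 2 + t ^+ 2))); last by ring.
    by rewrite st subrr mulr0 addr0 addr_ge0 ?sqr_ge0.
rewrite /h ge0_integralD//=; first last.
- by move=> _ _; rewrite lee_fin mulr_ge0 ?sqr_ge0.
- by apply: measurable_funeM; exact: measurable_normsq.
- by move=> x _; rewrite lee_fin mulr_ge0 ?normsq_ge0.
rewrite ge0_integralZl_EFin//; first last.
- exact: measurable_normsq.
- by move=> x _; rewrite lee_fin normsq_ge0.
rewrite integral_cst// [X in (_ + _ * X)%E](_ : _ = 1%E); last exact: probability_setT.
rewrite mule1.
apply: le_trans (leeD2r _ (lee_wpmul2l _ le)) _ => //.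
by rewrite -EFinM -EFinD lee_fin; nra.
Qed.

(** Integrability is included because an infinite integral also has real value 0, and because
    additivity requires it. *)
Definition zero_mean (g : point -> R) :=
  mu.-integrable setT (EFin \o g) /\ \int[mu]_x g x = 0.

Lemma zero_meanD (g h : point -> R) : zero_mean g -> zero_mean h -> zero_mean (g \+ h).
Proof.
move=> [ig g0] [ih h0]; split; first exact: (integrableD measurableT ig ih).
by rewrite RintegralD// g0 h0 addr0.
Qed.

Lemma zero_meanZ a (g : point -> R) : zero_mean g -> zero_mean (fun x => a * g x).
Proof.
move=> [ig g0]; split; first exact: (integrableZl measurableT a ig).
by rewrite RintegralZl// g0 mulr0.
Qed.

Lemma zero_mean_sum (I : finType) (F : I -> point -> R) :
  (forall i, zero_mean (F i)) -> zero_mean (fun x => \sum_i F i x).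
Proof.
move=> F0; elim: (index_enum I) => [|i s IH].
  under eq_fun do rewrite big_nil.
  by split; [exact: finite_measure_integrable_cst|rewrite Rintegral_cst// mul0r].
under eq_fun do rewrite big_cons.
exact: zero_meanD.
Qed.

Lemma integrable_normsq f : L2 f -> mu.-integrable setT (fun x => (normsq (f x))%:E).
Proof.
move=> [_ mr mi fin]; apply/integrableP; split; first exact: measurable_normsq.
under eq_integral do rewrite gee0_abs ?lee_fin ?normsq_ge0//.
by rewrite -L2normE; apply: poweR_lty.
Qed.

(** The two integrals are the parts of [inner (q n) f]. As |q| = 1, both integrands are bounded by 1
    + |f|^2, integrable for a finite measure. *)
Lemma zero_mean_inner f (n : freq) : L2 f -> inner (q n) f = 0 ->
  zero_mean (fun x => complex.Re ((q n x)^*%C * f x)) /\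
  zero_mean (fun x => complex.Im ((q n x)^*%C * f x)).
Proof.
move=> f2 []; have [_ mr mi _] := f2.
have mq : cmeasurable (fun x => (q n x)^*%C * f x).
  apply: (@cmeasurableM (fun x => (q n x)^*%C)); last by split.
  have [qr qi] := cmeasurable_q n; split => //.
  exact: (measurable_funN qi).
have dom : mu.-integrable setT (fun x => 1%:E + (normsq (f x))%:E)%E.
  apply: integrableD => //; last exact: integrable_normsq.
  exact: finite_measure_integrable_cst.
have bound x : normsq ((q n x)^*%C * f x) = normsq (f x).
  rewrite -[RHS]mul1r -(normsq_q n x) /normsq.
  by case: (q n x) (f x) => a b [s t] /=; ring.
have int (g : point -> R) : measurable_fun setT g ->
    (forall x, `|g x| <= 1 + normsq (f x)) -> mu.-integrable setT (EFin \o g).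
  move=> mg le; apply: (@le_integrable _ _ _ mu setT measurableT (EFin \o g) _ _ _ dom).
    exact/measurable_EFinP.
  by move=> x _ /=; rewrite lee_fin (le_trans (le _))// ler_norm.
move=> ir ii; have [mqr mqi] := mq; split; split => //; apply: int => // x.
  by rewrite -bound /normsq ler_norml; nra.
by rewrite -bound /normsq ler_norml; nra.
Qed.

(** Otherwise [f] is orthogonal to the span in which it can be approximated, so its norm is at most
    every approximation error, hence zero. *)
Lemma L20_inner_neq0 f : L20 f -> ~ (f = cst 0 %[ae mu]) ->
  exists2 n : freq, n != 0 & inner (q n) f != 0.
Proof.
move=> [f2 fcl] fN0; apply: contrapT => nex; apply: fN0.
have f_orth (n : freq) : n != 0 -> inner (q n) f = 0.
  by move=> n0; apply: contrapT => /eqP fn; apply: nex; exists n.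
have fint := integrable_normsq f2; have [_ mr mi _] := f2.
have small e : 0 < e -> \int[mu]_x normsq (f x) <= e ^+ 2.
  move=> e0; have [N [c [N0 le]]] := fcl e e0.
  pose g x := \sum_i (complex.Re (c i 0) * complex.Re ((q (idx i) x)^*%C * f x)
      + complex.Im (c i 0) * complex.Im ((q (idx i) x)^*%C * f x)).
  (* [g] is the real part of [(Q c)^* f], whose integral vanishes by orthogonality,
     so that [|f|^2 <= |f - Q c|^2 + 2 g] integrates to Bessel's bound. *)
  have [gint g0] : zero_mean g.
    apply: zero_mean_sum => i.
    have i0 : idx i != 0 by apply: contraNneq N0 => <-; exact: idx_in.
    have [zr zi] := zero_mean_inner f2 (f_orth _ i0).
    by apply: zero_meanD; exact: zero_meanZ.
  have gE x : g x = complex.Re (Q c x) * complex.Re (f x)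
      + complex.Im (Q c x) * complex.Im (f x).
    rewrite /Q !raddf_sum !mulr_suml -big_split; apply: eq_bigr => i _.
    by case: (c i 0) (q _ x) (f x) => a b [s t] [u v] /=; ring.
  move/(L2norm_le _ (ltW e0)): le => le.
  have dint : mu.-integrable setT (fun x => (normsq ((f \- Q c) x))%:E).
    apply/integrableP; split.
      by apply: measurable_normsq; apply: cmeasurableB (cmeasurable_Q _); split.
    under eq_integral do rewrite gee0_abs ?lee_fin ?normsq_ge0//.
    by apply: le_lt_trans le _; exact: ltry.
  have g2int := integrableZl measurableT 2 gint.
  apply: (@le_trans _ _ (\int[mu]_x (normsq ((f \- Q c) x) + 2 * g x))).
    apply: le_Rintegral => //.
      exact: (integrableD measurableT dint g2int).
    move=> x _; rewrite gE /normsq /=.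
    by case: (f x) (Q c x) => a b [s t] /=; nra.
  rewrite RintegralD//.
  rewrite RintegralZl// g0 mulr0 addr0 -lee_fin fineK//.
  exact: integrable_fin_num.
have I0 : \int[mu]_x normsq (f x) <= 0.
  rewrite leNgt; apply/negP => I0.
  (* For e = min(1, I/2), with I the integral, e^2 <= e <= I/2 < I. *)
  have := small (Num.min 1 (\int[mu]_x normsq (f x) / 2)).
  rewrite lt_min ltr01 divr_gt0//= => /(_ isT).
  by rewrite /Num.min; case: ifPn => [|/negPn]; nra.
have /ae_eq_integral_abs : (\int[mu]_x `|(normsq (f x))%:E| = 0)%E.
  under eq_integral do rewrite gee0_abs ?lee_fin ?normsq_ge0//.
  rewrite -[LHS]fineK; last exact: integrable_fin_num.
  congr EFin; apply/eqP; rewrite eq_le I0/=; apply: Rintegral_ge0 => x _.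
  exact: normsq_ge0.
move=> /(_ measurableT (measurable_normsq _)) ae.
have := ae (conj mr mi); apply: filterS => x /= /(_ I) [] /eqP.
by rewrite normsq_eq0 => /eqP.
Qed.

End TorusLTwo.

(** * Steering [v] to an approximation of [f] *)

Theorem theorem6 (R : realType) (d : nat) (d_gt0 : (0 < d)%N)
  (v : d.-tuple (measurableTypeR R) -> R[i])
  (vL20 : L20 v) (v_neq0 : ~ (v = cst 0 %[ae torus_prob R d]))
  (f : d.-tuple (measurableTypeR R) -> R[i])
  (fL20 : L20 f) (f_neq0 : ~ (f = cst 0 %[ae torus_prob R d]))
  (eps : R) (eps_gt0 : 0 < eps) :
  exists (N : {fset 'rV[int]_d}) (J : nat)
         (L : 'I_J -> 'M[R[i]]_#|{: N}|),
    [/\ 0 \notin N, (0 < J)%N, forall j, Tset (L j) &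
        (L2norm (f \- Q ((\prod_(j < J) expmx (L j)) *m Qadj N v))%R
           <= eps%:E)%E].
Proof.
have [b b0 vb] := L20_inner_neq0 vL20 v_neq0.
(* Half of [eps] is for the trigonometric approximation, half for the coefficient left at [m]. *)
have [[_ mfr mfi _] /(_ (eps / 2))] := fL20.
rewrite divr_gt0// => /(_ isT)[N1 [c [N10 fc]]].
have [h [ch hN1]] := ex_extension c.
pose N0 := (b |` N1)%fset.
have [m m0 m_far] := ex_far_from N0 (Ordinal d_gt0).
have bN0 : b \in N0 by rewrite fset1U1.
have mN0 : m \notin N0.
  by apply/negP => mN0; have [] := m_far _ _ _ mN0 bN0 bN0; rewrite !subrr eqxx.
pose N := (m |` N0)%fset.
have [im imE] : exists i : 'I_#|{: N}|, idx i = m by apply: ex_idx; rewrite fset1U1.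
have [ib ibE] : exists i : 'I_#|{: N}|, idx i = b.
  by apply: ex_idx; rewrite in_fset1U bN0 orbT.
(* The target keeps the approximating coefficients, zero at [b] when [b] is not in [N1], and has a
   small nonzero entry at [m], by which the second transvection divides. *)
pose G n : R[i] := if n == m then Complex (eps / 2) 0 else h n.
pose w := Qadj N v.
pose g : 'cV[R[i]]_#|{: N}| := \col_i G (idx i).
have gm : g im 0 != 0.
  by rewrite mxE imE /G eqxx eq_complex /= eqxx andbT gt_eqF ?divr_gt0.
have wb : w ib 0 != 0 by rewrite mxE ibE.
have bm : ib != im.
  by rewrite -(inj_eq (@idx_inj _ _)) ibE imE; apply: contraNneq mN0 => <-.
(* Index 0 is the left factor of the product, hence acts last. *)
pose L (j : 'I_2) := if j == 0 then
    (\col_i (if i == im then 0 else (g i 0 - w i 0) / g im 0)) *m delta_mx 0 im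
  else (((g im 0 - w im 0) / w ib 0) *: delta_mx im 0 : 'cV_#|{: N}|) *m delta_mx 0 ib.
exists N, 2%N, L; split => //.
- rewrite !in_fset1U !negb_or N10 andbT.
  by rewrite eq_sym m0 eq_sym b0.
- move=> j; rewrite /L; case: ifP => _.
    by apply: Tset_far_column => //; rewrite mxE eqxx.
  by apply: Tset_far_row; rewrite ?ibE.
have -> : (\prod_(j < 2) expmx (L j)) *m Qadj N v = g.
  rewrite big_ord_recl big_ord1 -[_ * _]/(_ *m _) -mulmxA.
  exact: steer_by_two_transvections.
have -> : (f \- Q g) = (f \- Q c) \- (fun x => Complex (eps / 2) 0 * q m x).
  apply/funext => x /=.
  rewrite (@QE _ _ _ _ G) => [|i]; last by rewrite mxE.
  rewrite (@QE _ _ _ _ h)// big_fsetU1//= {1}/G eqxx -[RHS]addrA -opprD [X in _ = _ - X]addrC.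
  congr (_ - (_ + _)).
  (* Enlarging [N1] by [b] adds nothing, since [h] vanishes off [N1]. *)
  rewrite (@big_fset_incl _ _ _ _ N1 N0) ?fsubsetU1// => [|n _ /hN1 ->]; last by rewrite mul0r.
  apply: eq_big_seq => n nN0; rewrite /G ifN//.
  by apply: contraNneq mN0 => <-.
apply: L2norm_subZq_le => //.
by apply: cmeasurableB (cmeasurable_Q _); split.
Qed.
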